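(* Let $n, x, y, a$ be integers such that $1\leq x,y\leq n$, $x\neq y$ and $1\leq a<n$. Let $d_x=\gcd(x,2n)$, $d_y=\gcd(y,2n)$ and $d=\gcd(x,y,2n)$. There exists a perfect matching $F$ of $K_{2n}$ such that $\ell(F)=\{x^{n-a}, y^a\}$ if and only if $d$ divides $n$ and one of the following cases occurs: (1) $\frac{x}{d}$ is even, $\frac{y}{d}$ is odd, $n-a$ is even, and either (a) $d_x$ divides $n$, or (b) $d_x$ does not divide $n$ and $2a\geq d_x$; (2) $\frac{x}{d}$ is odd, $\frac{y}{d}$ is even, $a$ is even, and either (a) $d_y$ divides $n$, or (b) $d_y$ does not divide $n$ and $2(n-a)\geq d_y$; (3) $\frac{x}{d}$ and $\frac{y}{d}$ are both odd, and both of the following hold: (a) $a$ is even or $da\geq d_x$; (b) $n-a$ is even or $d(n-a)\geq d_y$.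
   Context: For a positive integer $v$, $K_v$ denotes the complete graph on the vertex set $\{0,1,\ldots,v-1\}$. The length of an edge $\{u,w\}$ of $K_v$ is $\ell(u,w)=\min(|u-w|,\,v-|u-w|)$. For a subgraph $\Gamma$ of $K_v$, $\ell(\Gamma)$ is the list (multiset) of lengths of all edges of $\Gamma$, counted with multiplicity. A perfect matching of $K_{2n}$ is a set of $n$ pairwise disjoint edges covering all vertices. The notation $\{1^{a_1},2^{a_2},\ldots,t^{a_t}\}$ denotes the list containing $a_i$ copies of $i$ for each $i$. *)

(* Defs.v *)
From mathcomp Require Export all_boot.
From mathcomp Require Export ssrint.

Set Implicit Arguments.
Unset Strict Implicit.
Unset Printing Implicit Defensive.

Export IntDist.

(* Vertices of K_v are the elements of 'I_v; edges are the two-element sets of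
   vertices; a subgraph is identified with its set of edges. *)

Definition is_edge (v : nat) (e : {set 'I_v}) : bool := #|e| == 2.

Definition ell (v : nat) (u w : 'I_v) : nat :=
  minn `|u - w| (v - `|u - w|).

(* The default value 0 is never reached on an edge: see edge_lengthE. *)
Definition edge_length (v : nat) (e : {set 'I_v}) : nat :=
  if enum e is [:: u; w] then ell u w else 0.

(* Only meaningful up to perm_eq, i.e. as a multiset. *)
Definition lengths (v : nat) (G : {set {set 'I_v}}) : seq nat :=
  [seq edge_length e | e in G].

Definition perfect_matching (n : nat) (F : {set {set 'I_(2 * n)}}) : bool :=
  [&& #|F| == n, [forall e in F, is_edge e], trivIset F
    & cover F == [set: 'I_(2 * n)]].

Lemma ellC (v : nat) (u w : 'I_v) : ell u w = ell w u.
Proof. by rewrite /ell distnC. Qed.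

Lemma edge_lengthE (v : nat) (u w : 'I_v) :
  u != w -> edge_length [set u; w] = ell u w.
Proof.
move=> uw; rewrite /edge_length.
have : size (enum [set u; w]) = 2 by rewrite -cardE cards2 uw.
have := mem_enum [set u; w]; have := enum_uniq [set u; w].
case: (enum _) => [|p [|q [|]]] //=; rewrite inE andbT => pq E _.
have := E p; have := E q; rewrite !inE !eqxx orbT /=.
case/esym/orP=> /eqP qE; case/esym/orP=> /eqP pE; subst p q => //.
- by rewrite eqxx in pq.
- by rewrite ellC.
- by rewrite eqxx in pq.
Qed.

(* Main.v *)
(** A perfect matching with lengths x and y amounts to two sets X, Y of residues
    mod 2n such that X, X + x, Y, Y + y partition Z/2n.

    Necessity: count residues.  The classes mod d are unions of edges, hence even;
    the colouring of u by the parity of u / d (rounded down) gives the parity of a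
    when exactly one of x/d, y/d is even; if the classes mod d_x are odd, each
    meets a y-edge; if they are even, the numbers of y-edges leaving the classes
    i and i + y have the same parity, so that an odd a forces a y-edge out of
    each of the d_x / d classes of some orbit of translation by y.

    Sufficiency: let m = n/d, p = d_x/d, q = d_y/d.  Every class mod d is a
    twisted p by 2m/p torus grid, whose rows follow x.  Pairs of consecutive rows
    are cut into 2 by 2 blocks, each matched horizontally or vertically; this
    settles the case where p is even.  For p odd, one row is left over: it is
    matched horizontally, or it is cut by a vertical path which winds once around
    the torus.  Exchanging x and y covers the large values of a.  Only p = 1
    (or q = 1) leaves a gap, in which the class is a single x-cycle with chords
    y = s x, and the chords are placed explicitly.  Finally the numbers of
    y-edges available in one class are added over the d classes. *)

Require Import Defs.
From mathcomp Require Import all_algebra zify.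

Set Implicit Arguments.
Unset Strict Implicit.
Unset Printing Implicit Defensive.

Import GRing.Theory.

(** * Tilings of finite lists in an abelian group *)

(* [lia] compares its atoms up to syntax only, while the [count]s met here carry
   convertible but distinct presentations of the type of elements. *)
Local Ltac count_lia :=
  rewrite ?count_cat /= ?count_cat /=;
  repeat match goal with |- context [@count ?T ?P ?s] =>
    move: (@count T P s) => ? end; lia.

Local Ltac perm_count := apply/permP => ?; count_lia.

Section Tilings.
Variable G : zmodType.
Implicit Types (x y u : G) (V W : seq G).
Local Open Scope ring_scope.

(** [X] and [Y] list the starting ends of the edges. Lists up to permutation serve as multisets, so
    one [perm_eq] expresses covering and disjointness together. *)
Definition tiles x y V (a : nat) : Prop :=
  exists X Y : seq G, size Y = a /\
    perm_eq (X ++ [seq u + x | u <- X] ++ Y ++ [seq u + y | u <- Y]) V.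

Lemma tiles_perm x y V W a : perm_eq V W -> tiles x y V a -> tiles x y W a.
Proof. by move=> VW [X [Y [sY H]]]; exists X, Y; split=> //; apply: perm_trans VW. Qed.

Lemma tiles_cat x y V W a b :
  tiles x y V a -> tiles x y W b -> tiles x y (V ++ W) (a + b)%N.
Proof.
move=> [X [Y [<- H]]] [X' [Y' [<- H']]]; exists (X ++ X'), (Y ++ Y').
split; first by rewrite size_cat.
rewrite perm_sym; apply: (perm_trans (perm_cat _ _)).
- by rewrite perm_sym; exact: H.
- by rewrite perm_sym; exact: H'.
by rewrite !map_cat; perm_count.
Qed.

Lemma tilesC x y V a b :
  size V = (2 * (a + b))%N -> tiles x y V a -> tiles y x V b.
Proof.
move=> sV [X [Y [sY H]]]; exists Y, X; split.
  have := perm_size H; rewrite !size_cat !size_map sY sV.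
  by move: (size X) => k; lia.
by apply: perm_trans H; perm_count.
Qed.

(** A [y]-edge read from its other end is a [- y]-edge. *)
Lemma tilesNr x y V a : tiles x (- y) V a -> tiles x y V a.
Proof.
move=> [X [Y [sY H]]]; exists X, [seq u - y | u <- Y]; rewrite size_map.
split=> //; apply: perm_trans H; rewrite (mapK (subrK y)); perm_count.
Qed.

Lemma tiles_nil x y : tiles x y [::] 0.
Proof. by exists [::], [::]. Qed.

Lemma tiles_pair x y u : tiles x y [:: u; u + y] 1.
Proof. by exists [::], [:: u]. Qed.

(** Intervals of numbers of one fixed parity add up without gaps. *)
Lemma tiles_flatten x y (Vs : seq (seq G)) (lo hi : nat) (r : bool) :
    odd lo = r -> odd hi = r ->
    (forall V, V \in Vs -> forall a, (lo <= a <= hi)%N -> odd a = r ->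
       tiles x y V a) ->
  forall a, (size Vs * lo <= a <= size Vs * hi)%N -> odd a = r && odd (size Vs) ->
    tiles x y (flatten Vs) a.
Proof.
move=> olo ohi; elim: Vs => [|V Vs IH] H a /= ha oa.
  by have -> : a = 0%N; [lia | exact: tiles_nil].
rewrite !mulSn in ha; have hlh : (lo <= hi)%N.
  by rewrite -(leq_pmul2l (ltn0Sn (size Vs))) !mulSn; case/andP: ha => /leq_trans; apply.
have hK : (size Vs * lo <= size Vs * hi)%N by rewrite leq_mul2l hlh orbT.
have oK : odd (size Vs * hi) = odd (size Vs) && r by rewrite oddM ohi.
(* The first list takes the least number that the capacity of the others allows. *)
pose a1 := maxn lo (a - size Vs * hi).
have oa1 : odd a1 = r.
  rewrite /a1 /maxn; case: ltnP => h //.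
  by rewrite oddB ?oa ?oK; [case: (r); case: (odd _) | clear -h; lia].
have [h1 h2 h3] : [/\ (lo <= a1 <= hi)%N, (a1 <= a)%N
    & (size Vs * lo <= a - a1 <= size Vs * hi)%N].
  move: (size Vs * lo)%N (size Vs * hi)%N @a1 ha hK {oa1 oK oa} => A B a1 ha hK.
  by rewrite /a1; clear -ha hK hlh; split; lia.
have -> : a = (a1 + (a - a1))%N by rewrite subnKC.
apply: tiles_cat; first by apply: H; rewrite ?mem_head.
apply: IH; first by move=> W hW; apply: H; rewrite inE hW orbT.
  by [].
by rewrite oddB // oa oa1; case: (r); case: (odd _).
Qed.

(** * Paths in one direction and strips of two parallel paths *)

Definition seg x u (l : nat) : seq G := [seq u + x *+ j | j <- iota 0 l].

Lemma size_seg x u l : size (seg x u l) = l.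
Proof. by rewrite size_map size_iota. Qed.

Lemma segD x u k l : seg x u (k + l) = seg x u k ++ seg x (u + x *+ k) l.
Proof.
rewrite /seg iotaD map_cat add0n; congr (_ ++ _).
rewrite -{1}(addn0 k) iotaDl -map_comp; apply: eq_map => j /=.
by rewrite mulrnDr addrA.
Qed.

Lemma seg1 x u : seg x u 1 = [:: u].
Proof. by rewrite /seg /= mulr0n addr0. Qed.

Lemma seg2 x u : seg x u 2 = [:: u; u + x].
Proof. by rewrite /seg /= mulr0n addr0 mulr1n. Qed.

Lemma segS x u l : seg x u l.+1 = u :: seg x (u + x) l.
Proof. by rewrite -add1n segD seg1. Qed.

Lemma map_seg x u y l : [seq v + y | v <- seg x u l] = seg x (u + y) l.
Proof. by rewrite /seg -map_comp; apply: eq_map => j /=; rewrite addrAC. Qed.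

Lemma tiles_segr x y u k : tiles x y (seg y u (2 * k)) k.
Proof.
elim: k u => [|k IH] u; first by exists [::], [::].
by rewrite mulnS segD seg2 -[k.+1]add1n; apply: tiles_cat (tiles_pair _ _ _) (IH _).
Qed.

Lemma tiles_segl x y u k : tiles x y (seg x u (2 * k)) 0.
Proof. by apply: tilesC (tiles_segr y x u k); rewrite size_seg addn0. Qed.

Lemma tiles_segl_even x y u l : ~~ odd l -> tiles x y (seg x u l) 0.
Proof. by move=> ol; have -> : l = (2 * l./2)%N; [lia | apply: tiles_segl]. Qed.

Lemma tiles_shift x y u l : tiles x y (seg x u l ++ seg x (u + y) l) l.
Proof. by exists [::], (seg x u l); rewrite size_seg map_seg. Qed.

(** The first [a] columns are matched along [y]; the other [l - a], even in number, along the two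
    rows. *)
Lemma tiles_strip x y u l a : (a <= l)%N -> odd a = odd l ->
  tiles x y (seg x u l ++ seg x (u + y) l) a.
Proof.
move=> al oa; have -> : l = (a + (l - a))%N by lia.
have ol : ~~ odd (l - a) by rewrite oddB // oa addbb.
have T := tiles_cat (tiles_shift x y u a) (tiles_cat
  (tiles_segl_even x y (u + x *+ a) ol) (tiles_segl_even x y (u + y + x *+ a) ol)).
by rewrite !addn0 in T; apply: tiles_perm T; rewrite !segD; perm_count.
Qed.

(** * Grids of parallel rows *)

Definition rows x y (p l : nat) u : seq G :=
  flatten [seq seg x (u + y *+ k) l | k <- iota 0 p].

Lemma rowsD x y p1 p2 l u :
  rows x y (p1 + p2) l u = rows x y p1 l u ++ rows x y p2 l (u + y *+ p1).
Proof.
rewrite /rows iotaD map_cat flatten_cat add0n; congr (_ ++ _).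
rewrite -{1}(addn0 p1) iotaDl -map_comp; congr flatten; apply: eq_map => j /=.
by rewrite mulrnDr addrA.
Qed.

Lemma rows1 x y l u : rows x y 1 l u = seg x u l.
Proof. by rewrite /rows /= cats0 mulr0n addr0. Qed.

Lemma rows1r x y p u : rows x y p 1 u = seg y u p.
Proof. by rewrite /rows /seg; elim: (iota 0 p) => //= k s ->; rewrite mulr0n addr0. Qed.

Lemma size_rows x y p l u : size (rows x y p l u) = (p * l)%N.
Proof.
elim: p u => [|p IH] u //.
by rewrite -addn1 rowsD size_cat IH rows1 size_seg mulnDl mul1n.
Qed.

Lemma rows_splitr x y p l1 l2 u :
  perm_eq (rows x y p (l1 + l2) u) (rows x y p l1 u ++ rows x y p l2 (u + x *+ l1)).
Proof.
rewrite /rows; elim: (iota 0 p) => //= k s /permP IH.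
apply/permP=> P; have := IH P; rewrite segD !count_cat => ->.
by rewrite addrAC; count_lia.
Qed.

(** The rows form [h] strips of two; for odd [l] each strip needs a [y]-edge, whence the lower
    bound. *)
Lemma tiles_rows_even x y h l u a :
    (h * odd l <= a <= h * l)%N -> odd a = odd (h * l) ->
  tiles x y (rows x y (2 * h) l u) a.
Proof.
move=> ha oa.
pose Vs := [seq rows x y 2 l (u + y *+ (2 * k)) | k <- iota 0 h].
have -> : rows x y (2 * h) l u = flatten Vs.
  rewrite {}/Vs; elim: h {ha oa} => // h IH.
  rewrite mulnSr rowsD IH -[h.+1]addn1 iotaD map_cat flatten_cat /= cats0 add0n.
  by [].
have sV : size Vs = h by rewrite size_map size_iota.
apply: (@tiles_flatten _ _ _ (odd l) l (odd l)); rewrite ?sV //.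
- by case: (odd l).
- move=> V /mapP[k _ ->] b hb ob; rewrite (rowsD _ _ 1 1) !rows1 mulr1n.
  by apply: tiles_strip; lia.
- by rewrite oa oddM andbC.
Qed.

Lemma tiles_rows_odd_even x y h l u a :
    ~~ odd l -> (a <= h * l)%N -> ~~ odd a ->
  tiles x y (rows x y (2 * h).+1 l u) a.
Proof.
move=> ol ha oa; rewrite -add1n rowsD rows1 -[a]add0n.
apply: tiles_cat (tiles_segl_even _ _ _ ol) (tiles_rows_even _ _ _ _ _).
  by rewrite (negbTE ol) muln0 ha.
by rewrite oddM (negbTE ol) andbF; apply: negbTE.
Qed.

(* The vertical path from u through one vertex of each row closes up in row 0
   at an odd distance s from u, so that it cuts row 0 into even segments. *)
Lemma tiles_rows_odd_odd x y h l s u a :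
    ~~ odd l -> odd s -> (s < l)%N -> y *+ (2 * h).+1 = x *+ s ->
    ((2 * h).+1 <= a <= (h * l).+1)%N -> odd a ->
  tiles x y (rows x y (2 * h).+1 l u) a.
Proof.
move=> ol os sl Es ha oa.
have o1 : ~~ odd s.-1 by lia.
have o2 : ~~ odd (l - s.+1) by lia.
have ohl : odd (a - h.+1) = odd (h * l.-1).
  by rewrite oddB ?oddM; lia.
have hb : (h * odd l.-1 <= a - h.+1 <= h * l.-1)%N.
  have -> : odd l.-1 by lia.
  have l0 : (0 < l)%N by lia.
  have := mulnS h l.-1; rewrite prednK // => Eh; clear -ha Eh.
  by move: (h * l)%N (h * l.-1)%N ha Eh => A B; lia.
(* The path consists of [h.+1] vertical edges: the first column, then [u + x *+ s] in row 0. Outside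
   it lie two even segments of row 0 and [2 * h] rows of odd length [l.-1]. *)
have T := tiles_cat (tiles_segr x y u h.+1) (tiles_cat
  (tiles_segl_even x y (u + x) o1) (tiles_cat
  (tiles_segl_even x y (u + x *+ s.+1) o2)
  (tiles_rows_even x y (u + x + y) hb ohl))).
have Ea : (h.+1 + (0 + (0 + (a - h.+1))))%N = a by lia.
rewrite Ea in T; apply: tiles_perm T.
have El' : l = (1 + l.-1)%N by lia.
rewrite [in X in perm_eq _ X]El' perm_sym.
apply: perm_trans (rows_splitr _ _ _ _ _ _) _.
rewrite rows1r mulr1n -[in rows _ _ (2 * h).+1 _ _]add1n rowsD rows1 mulr1n.
have -> : (2 * h.+1 = (2 * h).+1 + 1)%N by lia.
rewrite segD seg1 Es.
have -> : seg x (u + x) l.-1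
    = seg x (u + x) s.-1 ++ (u + x *+ s) :: seg x (u + x *+ s.+1) (l - s.+1).
  have -> : l.-1 = (s.-1 + (1 + (l - s.+1)))%N by lia.
  rewrite segD; congr (_ ++ _); rewrite segD seg1 /= -!addrA -!mulrS mulr1n.
  by rewrite -mulrSr -mulrS prednK ?odd_gt0.
by perm_count.
Qed.

(** * A single cycle with parallel chords *)

Section OneRow.
Variables (x y : G) (s : nat).
Hypotheses (ys : y = x *+ s) (os : odd s).

(** Chords join the first [k] vertices to the last [k]; the [s - k] vertices between are even in
    number. *)
Lemma tiles_block u k : (k <= s)%N -> odd k -> tiles x y (seg x u (s + k)) k.
Proof.
move=> ks ok; have o1 : ~~ odd (s - k) by lia.
have T := tiles_cat (tiles_shift x y u k) (tiles_segl_even x y (u + x *+ k) o1).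
rewrite addn0 in T; apply: tiles_perm T.
have -> : (s + k = k + ((s - k) + k))%N by lia.
rewrite !segD -addrA -mulrnDr subnKC // -ys; perm_count.
Qed.

(** Places [b] consecutive blocks whose odd chord numbers, each at most [s], add up to [a]; they
    occupy [b * s + a] vertices and leave an even segment. *)
Lemma tiles_blocks b l u a :
    (b <= a <= b * s)%N -> odd a = odd b -> (b * s + a <= l)%N -> ~~ odd l ->
  tiles x y (seg x u l) a.
Proof.
elim: b l u a => [|b IH] l u a ha oa hl ol.
  by have -> : a = 0%N; [lia | apply: tiles_segl_even].
have s0 := odd_gt0 os.
(* The first block takes as many chords as it can while leaving one for each later block. *)
have [k [k1 k2 ok [hk1 hk2]]] : exists k, [/\ (k <= s)%N, (k <= a)%N, odd k
    & (b <= a - k)%N /\ (a - k <= b * s)%N].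
  rewrite mulSn in ha; have bs : (b <= b * s)%N by rewrite leq_pmulr.
  move: (b * s)%N bs ha {hl} => B bs ha; clear -oa os bs ha s0.
  have [h|h] := leqP (a - b) s; first by exists (a - b)%N; split; try split; lia.
  by exists s; split; try split; lia.
rewrite mulSn in hl; have skl : (s + k <= l)%N.
  by move: (b * s)%N hl => B; clear -k2; lia.
have -> : a = (k + (a - k))%N by lia.
have -> : l = ((s + k) + (l - (s + k)))%N by lia.
rewrite segD; apply: tiles_cat (tiles_block _ k1 ok) (IH _ _ _ _ _ _ _).
- by rewrite hk1.
- by clear -oa ok k2; lia.
- by move: (b * s)%N hl => B; clear -k2; lia.
- by clear -skl ol os ok; lia.
Qed.

Variable t : nat.
Hypothesis per : x *+ (2 * (s + t)) = 0.

(* r - 1 parallel chords leave u + x, ..., u + (r - 1) x; since 2 (s + t) x = 0,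
   the remaining vertex u is reached by the chord from u + (s + 2 t) x, which
   crosses all of them and makes the gap between their ends even. *)
Lemma tiles_cross u r : (0 < r <= 2 * t)%N -> ~~ odd r ->
  tiles x y (seg x u r ++ seg x (u + x *+ s.+1) (2 * t)) r.
Proof.
move=> hr or; have o1 : ~~ odd (2 * t - r) by lia.
pose w := u + x *+ (s + 2 * t).
have wy : w + y = u.
  rewrite /w ys -addrA -mulrnDr -[RHS]addr0 -per; congr (_ + x *+ _); lia.
have T := tiles_cat (tiles_pair x y w) (tiles_cat (tiles_shift x y (u + x) r.-1)
  (tiles_segl_even x y (u + x *+ (s + r)) o1)).
rewrite wy in T; have Er : (1 + (r.-1 + 0))%N = r by lia.
rewrite Er in T; apply: tiles_perm T.
have -> : seg x u r = u :: seg x (u + x) r.-1.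
  by rewrite -segS prednK //; lia.
have -> : (2 * t = r.-1 + ((2 * t - r) + 1))%N by lia.
rewrite segD segD seg1.
have -> : u + x *+ s.+1 = u + x + y by rewrite ys mulrS addrA.
have -> : u + x + y + x *+ r.-1 = u + x *+ (s + r).
  by rewrite ys -!addrA -!mulrnDr -mulrS; congr (_ + x *+ _); lia.
have -> : u + x *+ (s + r) + x *+ (2 * t - r) = w.
  by rewrite /w -!addrA -!mulrnDr; congr (_ + x *+ _); lia.
have -> : (r.-1 + (2 * t - r + 1) - r = 2 * t - r)%N by lia.
by perm_count.
Qed.

(** The cycle is cut into arcs of [s.+1] and [s + 2 * t - 1] vertices, and [c] vertices are already
    removed from the front of each. Crosses follow one another, all with [2 * t] chords except
    possibly the last. *)
Lemma tiles_crosses a c u :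
    (0 < t)%N -> ~~ odd c -> ~~ odd a -> (c + a <= s.+1)%N ->
  tiles x y (seg x (u + x *+ c) (s.+1 - c)
    ++ seg x (u + x *+ (c + s.+1)) (s + 2 * t - 1 - c)) a.
Proof.
move=> t0; elim/ltn_ind: a c => a IH c oc oa ca.
have [->|a0] := posnP a.
  by apply: (@tiles_cat _ _ _ _ 0 0); apply: tiles_segl_even; lia.
pose r := minn a (2 * t).
have r0 : (0 < r <= 2 * t)%N by rewrite /r; lia.
have or : ~~ odd r by rewrite /r; lia.
have T1 := tiles_cross (u + x *+ c) r0 or.
have T2 : tiles x y (seg x (u + x *+ (c + r)) (s.+1 - (c + r))
    ++ seg x (u + x *+ (c + s.+1 + 2 * t)) (s - 1 - c)) (a - r).
  rewrite /r /minn; case: ltnP => h.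
    rewrite subnn; apply: (@tiles_cat _ _ _ _ 0 0); apply: tiles_segl_even; lia.
  have := IH (a - 2 * t)%N _ (c + 2 * t)%N.
  have -> : (c + 2 * t + s.+1 = c + s.+1 + 2 * t)%N by lia.
  have -> : (s + 2 * t - 1 - (c + 2 * t) = s - 1 - c)%N by lia.
  by apply; lia.
have T := tiles_cat T1 T2.
have Ea : (r + (a - r))%N = a by rewrite /r; lia.
rewrite Ea in T; apply: tiles_perm T.
have -> : (s.+1 - c = r + (s.+1 - (c + r)))%N by rewrite /r; lia.
have -> : (s + 2 * t - 1 - c = 2 * t + (s - 1 - c))%N by lia.
rewrite [in X in perm_eq _ X]segD [in X in perm_eq _ (_ ++ X)]segD.
rewrite -!addrA -!mulrnDr; perm_count.
Qed.

(** Crosses give the even [a] up to [s.+1], one block the odd [a] up to [s]. A larger [a] forces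
    [s < t], which leaves room for several blocks. *)
Lemma tiles_one_row u a : (0 < t)%N -> (2 * a <= s + t)%N ->
  tiles x y (seg x u (2 * (s + t))) a.
Proof.
move=> t0 ha; have s0 := odd_gt0 os.
have [/andP[oa ale]|nh] := boolP (~~ odd a && (a <= s.+1)%N).
  have /(_ 0 u t0 isT oa) T := @tiles_crosses a.
  have {}T := T ale; apply: tiles_perm T.
  rewrite mulr0n addr0 add0n subn0 -segD; apply/permP => P.
  by congr (count P (seg _ _ _)); lia.
have [h|h] := leqP a s.
  by apply: (@tiles_blocks 1); lia.
(* The ceiling of a / s; one more block is used if [b] has the wrong parity. *)
pose b := ((a + s.-1) %/ s)%N.
have hb : (a <= b * s)%N && (b * s < a + s)%N.
  have := divn_eq (a + s.-1) s; have := ltn_pmod (a + s.-1) s0; rewrite -/b.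
  by move: (b * s)%N (_ %% _)%N => B r; clear -s0; lia.
have hba : (b <= a)%N.
  rewrite leqNgt; apply/negP => ab; have : (a.+1 * s <= b * s)%N by rewrite leq_mul2r ab orbT.
  have : (a <= a * s)%N by rewrite leq_pmulr.
  by rewrite mulSn; move: (a * s)%N (b * s)%N hb => A B; clear; lia.
have os2 : ~~ odd (2 * (s + t)) by rewrite oddM.
have [e|e] := eqVneq (odd a) (odd b).
  apply: (@tiles_blocks b) => //; first by case/andP: hb => ->; rewrite hba.
  by move: (b * s)%N hb => B; clear -ha h; lia.
have ba : b != a by apply: contraNneq e => ->.
apply: (@tiles_blocks b.+1) => //; rewrite ?mulSn /=.
- by move: (b * s)%N hb hba => B; clear -ba; lia.
- by clear -e; lia.
- by move: (b * s)%N hb => B; clear -ha h; lia.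
Qed.

End OneRow.

(** One of the chords [y] and [- y] spans less than half the cycle, since [s <> m]. *)
Lemma tiles_one_row_any (x y : G) s m u a :
    y = x *+ s -> odd s -> (s < 2 * m)%N -> s <> m -> x *+ (2 * m) = 0 ->
    (2 * a <= m)%N ->
  tiles x y (seg x u (2 * m)) a.
Proof.
move=> ys os sm nsm x0 ha; have [h|h] := ltnP s m.
  have Em : m = (s + (m - s))%N by lia.
  by rewrite Em; apply: (tiles_one_row ys) => //; rewrite -?Em //; lia.
apply: tilesNr; have Em : m = (2 * m - s + (s - m))%N by lia.
rewrite [in (2 * m)%N]Em; apply: (@tiles_one_row _ _ (2 * m - s)); rewrite -?Em //; try lia.
by rewrite mulrnBr ?x0 ?sub0r ?ys //; lia.
Qed.

(** * One residue class, and sums over the classes *)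

Lemma tiles_rows_low x y p l s u a :
    odd p -> odd s -> (s < 2 * l)%N -> y *+ p = x *+ s ->
    (a + l <= (p * l).+1)%N -> (odd a -> (p <= a)%N) ->
  tiles x y (rows x y p (2 * l) u) a.
Proof.
move=> op os sl Es ha hpa.
have Ep : p = (2 * p./2).+1 by lia.
have ol : ~~ odd (2 * l) by rewrite oddM.
have Epl : (p./2 * (2 * l) + l = p * l)%N by rewrite [in RHS]Ep; lia.
have opl : odd (p * l) = odd l by rewrite oddM op.
(* Odd [a] uses the winding path, which needs at least [l - 1] edges along [x]; even [a] uses a
   horizontal row, which needs [l]. *)
rewrite {1}Ep; have [oa|oa] := boolP (odd a).
  apply: (tiles_rows_odd_odd (s := s)) => //; rewrite -?Ep // (hpa oa) /=.
  by move: (p * l)%N (p./2 * _)%N ha Epl => A B; clear; lia.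
apply: tiles_rows_odd_even => //.
by move: (p * l)%N (p./2 * _)%N ha Epl opl => A B; clear -oa; lia.
Qed.

(** The grid along [x] gives all [a] up to [m - l + 1], the grid along [y] all [a] from [l' - 1] on.
    A chord that is a diameter of a single cycle makes the other grid consist of rows of length 2,
    and then there is no gap. *)
Lemma tiles_coset x y V m p q l l' s s' u v :
    (0 < m)%N -> odd p -> odd q -> (p * l = m)%N -> (q * l' = m)%N ->
    odd s -> (s < 2 * l)%N -> y *+ p = x *+ s -> x *+ (2 * l) = 0 ->
    odd s' -> (s' < 2 * l')%N -> x *+ q = y *+ s' -> y *+ (2 * l') = 0 ->
    (p = 1%N -> s = m -> q = m) -> (q = 1%N -> s' = m -> p = m) ->
    perm_eq (rows x y p (2 * l) u) V -> perm_eq (rows y x q (2 * l') v) V ->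
  forall a, (a <= m)%N -> (odd a -> (p <= a)%N) ->
    (odd (m - a) -> (q <= m - a)%N) ->
  tiles x y V a.
Proof.
move=> m0 op oq pl ql os sl Es x0 os' sl' Es' y0 psm qsm PV QV a am hp hq.
have sV : (size V = 2 * (m - a + a))%N.
  by rewrite -(perm_size PV) size_rows subnK // mulnCA pl.
have [h|h] := leqP (a + l) m.+1.
  by apply: tiles_perm PV _; apply: (tiles_rows_low (s := s)); rewrite ?pl.
have [h'|h'] := leqP l' a.+1.
  apply: tilesC sV _; apply: tiles_perm QV _.
  by apply: (tiles_rows_low (s := s')); rewrite ?ql //; lia.
have l'1 : l' <> 1%N by lia.
have l1 : l <> 1%N by lia.
(* In the gap, [l] exceeds m / 2 if [2 * a <= m], so [p = 1]; otherwise [l'] does, so [q = 1]. *)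
have [h2|h2] := leqP (2 * a) m.
  have p1 : p = 1%N.
    case: p {PV hp Es psm qsm} pl op => [|[|p]] //= pl _; rewrite !mulSn in pl.
    by move: (p * l)%N pl => A; lia.
  rewrite p1 mul1n in pl Es; subst l; rewrite p1 rows1 in PV.
  apply: tiles_perm PV _; apply: (@tiles_one_row_any _ _ s) => //.
  move/(psm p1) => qm; rewrite qm -[RHS]muln1 in ql; move/eqP: ql.
  by rewrite eqn_pmul2l // => /eqP.
have q1 : q = 1%N.
  case: q {QV hq Es' psm qsm} ql oq => [|[|q]] //= ql _; rewrite !mulSn in ql.
  by move: (q * l')%N ql => A; lia.
rewrite q1 mul1n in ql Es'; subst l'; rewrite q1 rows1 in QV.
apply: tilesC sV _; apply: tiles_perm QV _.
apply: (@tiles_one_row_any _ _ s') => //; last by lia.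
move/(qsm q1) => pm; rewrite pm -[RHS]muln1 in pl; move/eqP: pl.
by rewrite eqn_pmul2l // => /eqP.
Qed.

(* When m is odd, an odd (resp. even) number of tiles in one V ranges over
   [p, m] (resp. [0, m - q]); j is the largest admissible number of odd parts. *)
Lemma tiles_sumset x y (Vs : seq (seq G)) m p q :
    odd p -> odd q -> (p * q %| m)%N -> (0 < m)%N ->
    (forall V, V \in Vs -> forall a, (a <= m)%N -> (odd a -> (p <= a)%N) ->
      (odd (m - a) -> (q <= m - a)%N) -> tiles x y V a) ->
  forall a, (a <= size Vs * m)%N -> (odd a -> (p <= a)%N) ->
    (odd (size Vs * m - a) -> (q <= size Vs * m - a)%N) ->
  tiles x y (flatten Vs) a.
Proof.
move=> op oq pqm m0 H a am hp hq.
have pqle : (p * q <= m)%N by apply: dvdn_leq.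
have p0 := odd_gt0 op; have q0 := odd_gt0 oq.
have pm : (p <= m)%N by apply: leq_trans pqle; rewrite leq_pmulr.
have qm : (q <= m)%N by apply: leq_trans pqle; rewrite leq_pmull.
have [om|em] := boolP (odd m); last first.
  have ok b : (b <= size Vs * m)%N -> ~~ odd b -> tiles x y (flatten Vs) b.
    move=> hb eb; apply: (@tiles_flatten _ _ _ 0 m false); rewrite ?muln0 //.
    - exact: negbTE.
    - by move=> V hV c hc oc; apply: H; rewrite ?oc //; lia.
    - by rewrite (negbTE eb).
  (* For even [m] and odd [a], one list takes an odd number between [p] and [m - q], the others even
     numbers. *)
  have [oa|ea] := boolP (odd a); last exact: ok.
  have pqm2 : (p + q <= m)%N.
    case/dvdnP: pqm => -[|[|k]] Em; first by rewrite Em in m0.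
      by move: em; rewrite Em mul1n oddM op oq.
    have h1 : (p <= p * q)%N by rewrite leq_pmulr.
    have h2 : (q <= p * q)%N by rewrite leq_pmull.
    rewrite Em !mulSn; move: (p * q)%N (k * _)%N h1 h2 => A B; clear; lia.
  case: Vs H am hq {ok} => [|V Vs] /= H am hq; first by move: oa am; case: (a).
  rewrite mulSn in am hq.
  have eK : ~~ odd (size Vs * m) by rewrite oddM (negbTE em) andbF.
  have {}hq : (a + q <= m + size Vs * m)%N.
    by move: (size Vs * m)%N am hq eK => A; clear -em oa; lia.
  have {}hp := hp oa.
  have [b [b1 b2 ob [b3 b4]]] : exists b, [/\ (p <= b)%N, (b + q <= m)%N, odd b
      & (b <= a)%N /\ (a - b <= size Vs * m)%N].
    move: (size Vs * m)%N am hq eK => A am hq eK.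
    exists (maxn p (a - A)); split; try split; clear -op oa em pqm2 hp am hq eK; lia.
  have -> : a = (b + (a - b))%N by lia.
  apply: tiles_cat.
    apply: H; rewrite ?mem_head //; first by clear -b2; lia.
    by clear -b2; lia.
  apply: (@tiles_flatten _ _ _ 0 m false); rewrite ?muln0 //.
  - exact: negbTE.
  - move=> W hW c /andP[_ cm] oc; apply: H; rewrite ?oc // ?inE ?hW ?orbT //.
    by rewrite oddB // oc (negbTE em).
  - by clear -ob oa b3; lia.
set d := size Vs in am hq *.
(* [j] lists take an odd number, at least [p] each, so [j] has the parity of [a]. *)
pose P j := [&& j <= d, odd j == odd a & j * p <= a]%N.
have exP : exists j, P j.
  exists (odd a : nat); rewrite /P; case oa: (odd a) => //=.
  rewrite mul1n hp //= andbT; case: (d) am => //; clear -oa; lia.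
have leP j : P j -> (j <= d)%N by case/and3P.
have [j /and3P[jd /eqP oj ja] jmax] := ex_maxnP exP leP.
(* If one list is left, this is the hypothesis on [d * m - a], which is then odd. If at least two
   are left, [j + 2] can only fail through [(j + 2) * p > a], and [p * q <= m] concludes. *)
have hi : (a <= j * m + (d - j) * (m - q))%N.
  move Ei : (d - j)%N => i; have Ed : d = (i + j)%N by lia.
  case: i Ei Ed => [|[|i]] Ei Ed.
  - by rewrite addn0 -[j]add0n -Ed.
  - have odm : odd (d * m - a) by rewrite oddB // oddM om Ed /= oj andbT; case: (odd a).
    have := hq odm; rewrite Ed mulnDl !mul1n; move: (j * m)%N => A; clear -qm q0; lia.
  have {}jmax : (a + 2 <= (j + 2) * p)%N.
    rewrite leqNgt; apply/negP => h.
    have ojp : odd ((j + 2) * p) = odd a.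
      by rewrite oddM op andbT oddD oj addbF.
    have : P (j + 2)%N.
      apply/and3P; split; first by clear -Ed; lia.
        by rewrite oddD oj addbF.
      by move: ((j + 2) * p)%N h ojp => A; clear; lia.
    by move/jmax; clear; lia.
  case: p q op oq pqle jmax {pqm H hp hq pm p0 q0 P exP leP ja} qm
    => [|p] // [|q] // _ _ pqle jmax qm.
  have le1 : ((j + i.+2) * (p.+1 * q.+1) <= (j + i.+2) * m)%N.
    by rewrite leq_mul2l pqle orbT.
  (* [p.+1] and [q.+1] are the former [p] and [q]; [K] is the nonnegative difference, expanded. *)
  have [K EK] : exists K, ((j + i.+2) * (p.+1 * q.+1) + 2
      = (j + 2) * p.+1 + i.+2 * q.+1 + K)%N.
    by exists (j * p.+1 * q + p * (i * q.+1 + 2 * q))%N; clear; lia.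
  have le2 : (i.+2 * q.+1 <= i.+2 * m)%N by rewrite leq_mul2l qm orbT.
  rewrite mulnBr; rewrite [X in (_ <= X)%N]mulnDl in le1.
  move: (j * m)%N (i.+2 * m)%N (i.+2 * q.+1)%N ((j + 2) * p.+1)%N
    ((j + i.+2) * (p.+1 * q.+1))%N jmax le1 le2 EK => A B C D E; clear; lia.
rewrite -(cat_take_drop j Vs) flatten_cat.
have oq' : ~~ odd (m - q) by clear -om oq qm; lia.
have s1 : size (take j Vs) = j by rewrite size_take -/d; clear -jd; case: ltnP => //; lia.
have s2 : size (drop j Vs) = (d - j)%N by rewrite size_drop.
have jm : (j * p <= j * m)%N by rewrite leq_mul2l pm orbT.
(* [b] is the share of the [j] odd lists; each remaining list takes an even number up to [m - q]. *)
have [b [b1 b2 ob ba ab]] : exists b, [/\ (j * p <= b)%N, (b <= j * m)%N, odd b = odd j,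
    (b <= a)%N & (a - b <= (d - j) * (m - q))%N].
  have o1 : odd (j * p) = odd a by rewrite oddM op andbT.
  have o2 : odd ((d - j) * (m - q)) = false by rewrite oddM (negbTE oq') andbF.
  rewrite oj; move: (j * p)%N (j * m)%N ((d - j) * (m - q))%N o1 o2 ja hi jm.
  move=> A B C o1 o2 ja hi jm.
  exists (maxn A (a - C)); split; clear -o1 o2 ja hi jm; lia.
have -> : a = (b + (a - b))%N by clear -ba; lia.
apply: tiles_cat.
  apply: (@tiles_flatten _ _ _ p m true); rewrite ?s1 ?b1 //.
  move=> V /mem_take hV c hc oc; apply: H => //; clear -hc om oc; lia.
apply: (@tiles_flatten _ _ _ 0 (m - q) false); rewrite ?s2 ?muln0 ?ab //.
- exact: negbTE.
- by move=> V /mem_drop hV c hc oc; apply: H => //; clear -hc om oc qm; lia.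
- by rewrite oddB // ob oj addbb.
Qed.

End Tilings.

(** * Tilings of the integers mod 2n *)

Lemma modn_mul_cancel a M i j : 0 < M -> a * i = a * j %[mod M] ->
  i = j %[mod M %/ gcdn a M].
Proof.
move=> M0; wlog ij : i j / i <= j => [H E|].
  by case/orP: (leq_total i j) => h; [apply: H | apply/esym; apply: H].
move/esym/eqP; rewrite eqn_mod_dvd ?leq_mul2l ?ij ?orbT // -mulnBr => dv.
apply/esym/eqP; rewrite eqn_mod_dvd //.
set g := gcdn a M in dv *; have g0 : 0 < g by rewrite gcdn_gt0 M0 orbT.
have Ea : a = g * (a %/ g) by rewrite mulnC divnK ?dvdn_gcdl.
have EM : M = g * (M %/ g) by rewrite mulnC divnK ?dvdn_gcdr.
rewrite EM Ea -mulnA dvdn_pmul2l // Gauss_dvdr // in dv.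
by rewrite /coprime -(eqn_pmul2l g0) muln_gcdr -Ea -EM muln1 gcdnC.
Qed.

Lemma exists_mul_mod a M z : 0 < a -> 0 < M -> gcdn a M %| z ->
  exists2 s, s < M %/ gcdn a M & a * s = z %[mod M].
Proof.
move=> a0 M0 /dvdnP[k ->]; set g := gcdn a M.
have g0 : 0 < g by rewrite gcdn_gt0 M0 orbT.
have gM : g %| M by apply: dvdn_gcdr.
have Mg : 0 < M %/ g by rewrite divn_gt0 // dvdn_leq.
have [u v Eu _] := egcdnP M a0.
exists ((u * k) %% (M %/ g)); first by rewrite ltn_mod.
have ga : g %| a by apply: dvdn_gcdl.
set Q := M %/ g in Mg *; set w := u * k.
(* [a * Q] is a multiple of [M], so the Bezout multiplier [w] can be reduced mod [Q]. *)
have EaQ : a * Q = (a %/ g) * M by rewrite -{1}(divnK ga) -mulnA [g * _]mulnC divnK.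
have E : w %/ Q * (a %/ g) * M + a * (w %% Q) = v * k * M + k * g.
  rewrite -mulnA -EaQ mulnCA -mulnDr -divn_eq /w.
  by rewrite mulnA [a * u]mulnC Eu mulnDl; lia.
by rewrite -[LHS](modnMDl (w %/ Q * (a %/ g))) E modnMDl.
Qed.

(** [tiles] for ['Z_N] on the representatives below [N], a form suited to counting. *)
Definition cyclic_tiling N x y (X Y : seq nat) : bool :=
  perm_eq (X ++ [seq (u + x) %% N | u <- X] ++ Y ++ [seq (u + y) %% N | u <- Y])
    (iota 0 N).

Section Residues.
Local Open Scope ring_scope.

Lemma natr_Zp_eq N i j : (1 < N)%N ->
  ((i%:R : 'Z_N) = j%:R) <-> (i = j %[mod N])%N.
Proof.
move=> N1; split=> [/(congr1 val)|E]; first by rewrite /= !val_Zp_nat.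
by apply: val_inj; rewrite /= !val_Zp_nat.
Qed.

Definition residue_class d m c : seq 'Z_(d * (2 * m)) :=
  [seq (c + d * v)%:R | v <- iota 0 (2 * m)].

(** Reduction mod [p] determines the row, as [y] is invertible mod [p]; the position in the row is
    then determined because [x] has order [L] mod [2 * m]. Cardinalities do the rest. *)
Lemma rows_residue_class d m x y c :
    (0 < d)%N -> (0 < m)%N -> gcdn x (gcdn y (2 * m)) = 1%N ->
  perm_eq (rows (d * x)%:R (d * y)%:R (gcdn x (2 * m)) (2 * m %/ gcdn x (2 * m)) c%:R)
    (residue_class d m c).
Proof.
move=> d0 m0 g1; set p := gcdn x (2 * m); set L := (_ %/ p)%N.
have m20 : (0 < 2 * m)%N by rewrite muln_gt0.
have N1 : (1 < d * (2 * m))%N by nia.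
have p0 : (0 < p)%N by rewrite gcdn_gt0 m20 orbT.
have pL : (p * L = 2 * m)%N by rewrite mulnC divnK ?dvdn_gcdr.
have pxv : (p %| x)%N by apply: dvdn_gcdl.
have pmv : (p %| 2 * m)%N by apply: dvdn_gcdr.
pose f k j : 'Z_(d * (2 * m)) := (c + d * (y * k + x * j))%:R.
have Er : rows (d * x)%:R (d * y)%:R p L c%:R
    = [seq f k j | k <- iota 0 p, j <- iota 0 L].
  rewrite /rows; congr flatten; apply: eq_map => k; apply: eq_map => j.
  by rewrite /f -!mulrnA -!natrD; congr (_%:R); lia.
have ur : uniq [seq f k j | k <- iota 0 p, j <- iota 0 L].
  apply: allpairs_uniq; rewrite ?iota_uniq // => z z'.
  move=> /allpairsP[[k j] [/= hk hj ->]] /allpairsP[[k' j'] [/= hk' hj' ->]] /=.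
  rewrite !mem_iota /= !add0n in hk hj hk' hj'.
  move=> /natr_Zp_eq-/(_ N1)/eqP; rewrite eqn_modDl -!muln_modr eqn_pmul2l //.
  move=> /eqP E.
  have cyp : gcdn y p = 1%N by rewrite gcdnCA.
  have Ek : k = k'.
    have : (y * k = y * k' %[mod p])%N.
      have := congr1 (modn^~ p) E; rewrite !modn_dvdm //.
      have hx i i' : (y * i + x * i' = y * i %[mod p])%N.
        by rewrite -(divnK pxv) mulnAC addnC modnMDl.
      by rewrite !hx.
    by move/(modn_mul_cancel p0); rewrite cyp divn1 !modn_small.
  rewrite -Ek in E *; congr (_, _); move/eqP: E; rewrite eqn_modDl => /eqP.
  by move/(modn_mul_cancel m20); rewrite -/p -/L !modn_small.
have sub : {subset [seq f k j | k <- iota 0 p, j <- iota 0 L] <= residue_class d m c}.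
  move=> _ /allpairsP[[k j] [_ _ ->]]; apply/mapP.
  exists ((y * k + x * j) %% (2 * m))%N; first by rewrite mem_iota ltn_mod.
  apply/natr_Zp_eq => //; by rewrite -[in RHS]modnDmr -[in LHS]modnDmr !muln_modr modn_mod.
have sz : (size (residue_class d m c) <= size [seq f k j | k <- iota 0 p, j <- iota 0 L])%N.
  by rewrite size_allpairs !size_iota pL size_map size_iota.
rewrite Er; apply: uniq_perm => //.
  exact: leq_size_uniq ur sub sz.
by case: (uniq_min_size ur sub sz).
Qed.

Lemma flatten_residue_class d m : (0 < d)%N -> (0 < m)%N ->
  perm_eq (flatten [seq residue_class d m c | c <- iota 0 d]) (enum 'Z_(d * (2 * m))).
Proof.
move=> d0 m0; have N1 : (1 < d * (2 * m))%N by nia.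
set s := flatten _.
have sub : {subset enum 'Z_(d * (2 * m)) <= s}.
  move=> u _; apply/flatten_mapP; exists (u %% d)%N.
    by rewrite mem_iota ltn_mod.
  apply/mapP; exists (u %/ d)%N.
    have uN : (u < d * (2 * m))%N by rewrite -[ltnRHS](Zp_cast N1) ltn_ord.
    by rewrite mem_iota /= add0n ltn_divLR //; apply: leq_trans uN _; lia.
  have -> : (u %% d + d * (u %/ d) = u)%N.
    by rewrite addnC [(d * (u %/ d))%N]mulnC -divn_eq.
  by rewrite natr_Zp.
have sz : (size s <= size (enum 'Z_(d * (2 * m))))%N.
  have -> : size s = (d * (2 * m))%N.
    have := size_allpairs (fun c v => (c + d * v)%:R : 'Z_(d * (2 * m)))
      (iota 0 d) (iota 0 (2 * m)); rewrite !size_iota; exact.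
  by rewrite -cardE card_ord Zp_cast.
have ue := enum_uniq 'Z_(d * (2 * m)).
rewrite perm_sym; apply: uniq_perm => //; first exact: leq_size_uniq ue sub sz.
by case: (uniq_min_size ue sub sz).
Qed.

Lemma natrM_Zp_eq d m i j : (0 < d)%N -> (0 < m)%N ->
  (i = j %[mod 2 * m])%N -> ((d * i)%:R : 'Z_(d * (2 * m))) = (d * j)%:R.
Proof.
by move=> d0 m0 E; apply/natr_Zp_eq; [nia | rewrite -!muln_modr E].
Qed.

(** Since [p] is even, each class is a grid of h = p / 2 strips. Odd row length costs one [y]-edge
    per strip, [d * h] in all; if [p] divides [m], the length is even. *)
Lemma tiles_residues_even d m x y a :
    (0 < d)%N -> (0 < m)%N -> gcdn x (gcdn y (2 * m)) = 1%N -> ~~ odd x ->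
    (a <= d * m)%N -> ~~ odd (d * m - a) ->
    (gcdn x (2 * m) %| m)%N \/ (d * gcdn x (2 * m) <= 2 * a)%N ->
  tiles (d * x)%:R (d * y)%:R (enum 'Z_(d * (2 * m))) a.
Proof.
move=> d0 m0 g1 ex am ea; set p := gcdn x (2 * m) => hp.
have m20 : (0 < 2 * m)%N by rewrite muln_gt0.
have p2 : (2 %| p)%N by rewrite dvdn_gcd dvdn2 ex dvdn_mulr.
have p0 : (0 < p)%N by rewrite gcdn_gt0 m20 orbT.
pose h := (p %/ 2)%N; pose L := (2 * m %/ p)%N.
have Ep : p = (2 * h)%N by rewrite mulnC divnK.
have pL : (p * L = 2 * m)%N by rewrite mulnC divnK ?dvdn_gcdr.
have hL : (h * L = m)%N by apply/eqP; rewrite -(eqn_pmul2l (ltn0Sn 1)) mulnA -Ep pL.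
apply: tiles_perm (flatten_residue_class d0 m0) _.
have sz : size [seq residue_class d m c | c <- iota 0 d] = d.
  by rewrite size_map size_iota.
apply: (@tiles_flatten _ _ _ _ (h * odd L) m (odd m)); rewrite ?sz //.
- by rewrite -hL !oddM; case: (odd L).
- move=> V /mapP[c _ ->] b hb ob.
  apply: tiles_perm (rows_residue_class c d0 m0 g1) _.
  by rewrite -/p -/L {1}Ep; apply: tiles_rows_even; rewrite hL.
- rewrite am andbT; case: hp => [/dvdnP[k Ek]|hp].
    have -> : odd L = false; last by rewrite !muln0.
    have -> : L = (2 * k)%N by rewrite /L Ek mulnA mulnK.
    by rewrite oddM.
  have : (d * h <= a)%N by rewrite -(leq_pmul2l (ltn0Sn 1)) mulnCA -Ep.
  by apply: leq_trans; rewrite leq_mul2l; case: (odd L); rewrite ?muln1 ?muln0 ?leqnn ?leq0n orbT.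
- by move: ea; rewrite oddB // oddM andbC; case: (_ && _); case: (odd a).
Qed.

Lemma odd_gcd_half x m : odd x -> (gcdn x (2 * m) %| m)%N.
Proof.
move=> ox; have : (gcdn x (2 * m) %| 2 * m)%N by apply: dvdn_gcdr.
rewrite Gauss_dvdr // coprimen2.
by apply: dvdn_odd (dvdn_gcdl _ _) ox.
Qed.

(** [s] is the twist of the torus: going up [p] rows returns to the first row, shifted by [s].
    Comparing parities modulo [2 * m] makes it odd. In the last clause [y] is a diameter, so [m]
    divides [y]. *)
Lemma exists_odd_shift d m x y : (0 < d)%N -> (0 < m)%N -> odd x -> odd y ->
  let p := gcdn x (2 * m) in
  exists s, [/\ odd s, (s < 2 * (m %/ p))%N,
     (d * y)%:R *+ p = (d * x)%:R *+ s :> 'Z_(d * (2 * m)) &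
     p = 1%N -> s = m -> gcdn y (2 * m) = m].
Proof.
move=> d0 m0 ox oy p; have m20 : (0 < 2 * m)%N by rewrite muln_gt0.
have pm : (p %| m)%N := odd_gcd_half m ox.
have op : odd p := dvdn_odd (dvdn_gcdl _ _) ox.
have x0 := odd_gt0 ox.
have [s sL E] := @exists_mul_mod x (2 * m) (p * y) x0 m20 (dvdn_mulr _ (dvdnn p)).
have Eodd : odd (x * s) = odd (p * y).
  have o2 : odd (2 * m) = false by rewrite oddM.
  by rewrite -(odd_mod (x * s) o2) E odd_mod.
exists s; split.
- by move: Eodd; rewrite !oddM ox op oy.
- by rewrite muln_divA.
- rewrite -!mulrnA -!mulnA [(y * p)%N]mulnC.
  by apply: natrM_Zp_eq.
- move=> p1 sm; rewrite p1 mul1n sm in E.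
  apply/eqP; rewrite eqn_dvd odd_gcd_half //= dvdn_gcd dvdn_mull // andbT.
  have : (2 * (x * m) = 2 * y %[mod 2 * m])%N by rewrite -modnMmr E modnMmr.
  rewrite mulnCA modnMl => /esym/eqP; rewrite -/(dvdn _ _).
  by rewrite dvdn_pmul2l.
Qed.

Lemma tiles_residues_odd d m x y a :
    (0 < d)%N -> (0 < m)%N -> gcdn x (gcdn y (2 * m)) = 1%N -> odd x -> odd y ->
    (a <= d * m)%N -> (odd a -> (gcdn x (2 * m) <= a)%N) ->
    (odd (d * m - a) -> (gcdn y (2 * m) <= d * m - a)%N) ->
  tiles (d * x)%:R (d * y)%:R (enum 'Z_(d * (2 * m))) a.
Proof.
move=> d0 m0 g1 ox oy am hp hq.
have g1' : gcdn y (gcdn x (2 * m)) = 1%N by rewrite gcdnCA.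
apply: tiles_perm (flatten_residue_class d0 m0) _.
have sz : size [seq residue_class d m c | c <- iota 0 d] = d.
  by rewrite size_map size_iota.
have op : odd (gcdn x (2 * m)) := dvdn_odd (dvdn_gcdl _ _) ox.
have oq : odd (gcdn y (2 * m)) := dvdn_odd (dvdn_gcdl _ _) oy.
have pm := odd_gcd_half m ox; have qm := odd_gcd_half m oy.
have [s [os sL Es Em]] := exists_odd_shift d0 m0 ox oy.
have [s' [os' sL' Es' Em']] := exists_odd_shift d0 m0 oy ox.
have per z : (gcdn z (2 * m) %| m)%N ->
    (d * z)%:R *+ (2 * (m %/ gcdn z (2 * m))) = 0 :> 'Z_(d * (2 * m)).
  move=> zm; have -> : 0 = (d * 0)%:R :> 'Z_(d * (2 * m)) by rewrite muln0.
  rewrite -mulrnA -mulnA; apply: natrM_Zp_eq => //.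
  by rewrite muln_divA // muln_divCA_gcd modnMr mod0n.
apply: (tiles_sumset (m := m) op oq) => //; rewrite ?sz //.
  (* The two gcds are coprime and both divide [m], hence so does their product. *)
  rewrite Gauss_dvd ?pm //.
  by rewrite /coprime -gcdnA [gcdn (2 * m) _]gcdnCA gcdnn g1.
move=> V /mapP[c _ ->] b bm hb hb'.
have rP z w : gcdn z (gcdn w (2 * m)) = 1%N -> (gcdn z (2 * m) %| m)%N ->
    perm_eq (rows (d * z)%:R (d * w)%:R (gcdn z (2 * m)) (2 * (m %/ gcdn z (2 * m))) c%:R)
    (residue_class d m c).
  by move=> gz zm; rewrite muln_divA //; apply: rows_residue_class.
apply: (tiles_coset (m := m) (p := gcdn x (2 * m)) (q := gcdn y (2 * m))
  (l := m %/ gcdn x (2 * m)) (l' := m %/ gcdn y (2 * m)) (s := s) (s' := s')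
  (u := c%:R) (v := c%:R)); rewrite ?per ?rP //.
- by rewrite mulnC divnK.
- by rewrite mulnC divnK.
Qed.

Lemma tiles_nat N x y a : (1 < N)%N -> tiles (x%:R : 'Z_N) y%:R (enum 'Z_N) a ->
  exists X Y : seq nat, size Y = a /\ cyclic_tiling N x y X Y.
Proof.
move=> N1 [X [Y [sY H]]].
exists (map val X), (map val Y); rewrite size_map; split=> //.
have vE : map val (enum 'Z_N) = iota 0 N by rewrite val_enum_ord Zp_cast.
have E z (u : 'Z_N) : val (u + z%:R) = ((val u + z) %% N)%N.
  rewrite /= val_Zp_nat //; move: (nat_of_ord u) => k.
  by rewrite Zp_cast // modnDmr.
have := perm_map val H; rewrite vE !map_cat -!map_comp.
by rewrite !(eq_map (E _)) /cyclic_tiling -!map_comp.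
Qed.

End Residues.

(** * Counting residues *)

Lemma count_iota_mod g L (Q : pred nat) :
  count (fun u => Q (u %% g)) (iota 0 (L * g)) = L * count Q (iota 0 g).
Proof.
elim: L => [|L IH]; first by rewrite mul0n.
rewrite !mulSnr iotaD count_cat IH; congr (_ + _).
rewrite add0n -{1}(addn0 (L * g)) iotaDl count_map.
apply: eq_in_count => u; rewrite mem_iota => /andP[_ ug] /=.
by rewrite modnMDl modn_small.
Qed.

Lemma count_iota_residue g L i : i < g ->
  count (fun u => u %% g == i) (iota 0 (L * g)) = L.
Proof.
move=> ig; rewrite (count_iota_mod _ _ (pred1 i)).
by rewrite count_uniq_mem ?iota_uniq // mem_iota ig muln1.
Qed.

Section Necessity.
Variables (N x y : nat) (X Y : seq nat).
Hypothesis tXY : cyclic_tiling N x y X Y.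

Lemma cyclic_tilingC : cyclic_tiling N y x Y X.
Proof.
apply: perm_trans tXY; apply/permP => P; rewrite !count_cat; lia.
Qed.

Lemma cyclic_tiling_size : 2 * (size X + size Y) = N.
Proof.
have := perm_size tXY; rewrite !size_cat !size_map size_iota.
by move: (size X) (size Y) => a b; lia.
Qed.

(** The divisibility and parity conditions come from this double count, applied to suitable unions
    of residue classes. *)
Lemma cyclic_tiling_count (P : pred nat) : (forall u, P (u %% N) = P u) ->
  count P (iota 0 N) = count P X + count (fun u => P (u + x)) X
    + count P Y + count (fun u => P (u + y)) Y.
Proof.
move=> PN; have E z s : count P [seq (u + z) %% N | u <- s] = count (fun u => P (u + z)) s.
  by rewrite count_map; apply: eq_count => u /=; rewrite PN.
by rewrite -(permP tXY) !count_cat !E !addnA.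
Qed.

Variable n : nat.
Hypothesis N2 : N = 2 * n.

(** Edges stay inside the class of 0 mod [d], so its size N / d is even. *)
Lemma cyclic_tiling_dvd d : 0 < d -> d %| x -> d %| y -> d %| N -> d %| n.
Proof.
move=> d0 dx dy dN; have [L EN] := dvdnP dN.
have PN u : (u %% N %% d == 0) = (u %% d == 0) by rewrite modn_dvdm.
have := cyclic_tiling_count PN; rewrite {1}EN count_iota_residue //.
rewrite (@eq_count _ (fun u => (u + x) %% d == 0) (fun u => u %% d == 0)); last first.
  by move=> u /=; rewrite -!/(dvdn _ _) dvdn_addl.
rewrite (@eq_count _ (fun u => (u + y) %% d == 0) (fun u => u %% d == 0)); last first.
  by move=> u /=; rewrite -!/(dvdn _ _) dvdn_addl.
set A := count _ X; set B := count _ Y => EL.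
have : 2 * n = 2 * ((A + B) * d) by rewrite -N2 EN EL mulnA; congr (_ * _); lia.
by move/eqP; rewrite eqn_pmul2l // => /eqP ->; rewrite dvdn_mull.
Qed.

(** Half of the residues, [n] in number, have one colour; an [x]-edge has no end or both ends there,
    a [y]-edge exactly one. *)
Lemma cyclic_tiling_parity d m x' y' :
    0 < d -> n = d * m -> x = d * x' -> y = d * y' -> ~~ odd x' -> odd y' ->
  odd (size Y) = odd n.
Proof.
move=> d0 En Ex Ey ox oy.
have EN : N = m * (2 * d) by rewrite N2 En; lia.
have d2N : 2 * d %| N by rewrite EN dvdn_mull.
pose P u := u %% (2 * d) < d.
have PN u : P (u %% N) = P u by rewrite /P modn_dvdm.
have Px u : P (u + x) = P u.
  have -> : u + x = x'./2 * (2 * d) + u.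
    by rewrite Ex [in LHS](_ : x' = 2 * x'./2); lia.
  by rewrite /P modnMDl.
have Py u : P (u + y) = ~~ P u.
  have -> : u + y = y'./2 * (2 * d) + (u + d).
    by rewrite Ey [in LHS](_ : y' = (2 * y'./2).+1); lia.
  rewrite /P modnMDl -modnDml; have d20 : 0 < 2 * d by rewrite muln_gt0.
  have := ltn_pmod u d20; move: (u %% _) => r hr.
  case: (ltnP r d) => h; first by rewrite modn_small; lia.
  have -> : r + d = 1 * (2 * d) + (r - d) by lia.
  by rewrite modnMDl modn_small; lia.
have := cyclic_tiling_count PN; rewrite {1}EN (count_iota_mod _ _ (fun r => r < d)).
have -> : count (fun r => r < d) (iota 0 (2 * d)) = d.
  rewrite mul2n -addnn iotaD count_cat add0n.
  rewrite (@eq_in_count _ _ predT (iota 0 d)); last by move=> u; rewrite mem_iota.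
  rewrite (@eq_in_count _ _ pred0 (iota d d)); last first.
    by move=> u; rewrite mem_iota /= => /andP[h _]; rewrite ltnNge h.
  by rewrite count_predT count_pred0 size_iota addn0.
rewrite (eq_count Px) (eq_count Py) -addnA count_predC mulnC -En.
by move=> ->; lia.
Qed.

(** Each of the [g] classes has odd size, so [x]-edges cannot cover it: it contains one of the
    [2 * size Y] ends of [y]-edges. *)
Lemma cyclic_tiling_odd_cycles g : g %| x -> g %| N -> ~~ (g %| n) ->
  g <= 2 * size Y.
Proof.
move=> gx gN gn; have [->//|g0] := posnP g.
have [L EN] := dvdnP gN.
have oL : odd L.
  apply: contraNT gn => oL; apply/dvdnP; exists L./2.
  by apply/eqP; rewrite -(eqn_pmul2l (ltn0Sn 1)) -N2 EN mulnA; apply/eqP; congr (_ * _); lia.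
have -> : 2 * size Y = size [seq u %% g | u <- Y ++ [seq u + y | u <- Y]].
  by rewrite size_map size_cat size_map; lia.
rewrite -[leqLHS](size_iota 0 g); apply: uniq_leq_size (iota_uniq _ _) _ => i.
rewrite mem_iota /= => ig.
have PN u : (u %% N %% g == i) = (u %% g == i) by rewrite modn_dvdm.
have := cyclic_tiling_count PN; rewrite {1}EN count_iota_residue //.
rewrite (@eq_count _ (fun u => (u + x) %% g == i) (fun u => u %% g == i)); last first.
  by move=> u /=; have [k ->] := dvdnP gx; rewrite addnC modnMDl.
move=> EL; have : has (fun u => u %% g == i) (Y ++ [seq u + y | u <- Y]).
  rewrite has_count count_cat count_map.
  rewrite (@eq_count _ (preim (addn^~ y) (fun u => u %% g == i))
    (fun u => (u + y) %% g == i)); last by [].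
  by lia.
by case/hasP=> u uY /eqP <-; apply: map_f.
Qed.

Lemma odd_residue_count g (s : seq nat) : 0 < g -> odd (size s) ->
  exists2 i, i < g & odd (count (fun u => u %% g == i) s).
Proof.
move=> g0; have -> : size s = \sum_(i < g) count (fun u => u %% g == i) s.
  elim: s => [|u s IH] /=; first by rewrite big1.
  rewrite big_split /= -IH; have ug : u %% g < g by rewrite ltn_mod.
  rewrite (bigD1 (Ordinal ug)) //= eqxx big1 // => i.
  by rewrite -val_eqE /= eq_sym => /negbTE ->.
move=> H; have [|h] := boolP [exists i : 'I_g, odd (count (fun u => u %% g == i) s)].
  by case/existsP=> i oi; exists i.
move: H; rewrite (big_morph odd oddD (erefl _)) big1 // => i _.
by apply: negbTE; move: h; rewrite negb_exists => /forallP.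
Qed.

(* The number of y-edges leaving a residue class mod g has the same parity as
   the number entering it, because the class is even and x-edges stay inside. *)
Lemma cyclic_tiling_even_cycles g : 0 < g -> g %| x -> g %| n -> odd (size Y) ->
  g %/ gcdn y g <= size Y.
Proof.
move=> g0 gx gn oY; have [k En] := dvdnP gn.
have EN : N = (2 * k) * g by rewrite N2 En mulnA.
have gN : g %| N by rewrite EN dvdn_mull.
pose e i := count (fun u => u == i %[mod g]) Y.
have eS i : odd (e (i + y)) = odd (e i).
  have PN u : (u %% N == i + y %[mod g]) = (u == i + y %[mod g]) by rewrite modn_dvdm.
  have := cyclic_tiling_count PN; rewrite {1}EN.
  rewrite (@count_iota_residue g (2 * k) ((i + y) %% g)) ?ltn_mod //.
  rewrite (@eq_count _ (fun u => u + x == i + y %[mod g])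
     (fun u => u == i + y %[mod g])); last first.
    by move=> u /=; have [l ->] := dvdnP gx; rewrite [u + _]addnC modnMDl.
  rewrite (@eq_count _ (fun u => u + y == i + y %[mod g])
     (fun u => u == i %[mod g])); last by move=> u /=; rewrite eqn_modDr.
  by rewrite -/(e _) -/(e _) => E; lia.
have [i0 i0g oi0] := odd_residue_count g0 oY.
have oe j : odd (e (i0 + y * j)).
  elim: j => [|j IH]; last by rewrite mulnSr addnA eS.
  by rewrite muln0 addn0 /e (@modn_small i0).
(* The orbit of [i0] under translation by [y] has [g %/ gcdn y g] classes, each left by an odd
   number of [y]-edges. *)
pose f j := (i0 + y * j) %% g.
rewrite -(size_map (modn^~ g)) -[leqLHS](size_iota 0) -(size_map f).
apply: uniq_leq_size.
  rewrite map_inj_in_uniq ?iota_uniq // => j j'; rewrite !mem_iota /= !add0n => hj hj'.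
  by move/eqP; rewrite eqn_modDl => /eqP/(modn_mul_cancel g0); rewrite !modn_small.
move=> _ /mapP[j _ ->]; have := oe j => /odd_gt0; rewrite -has_count => /hasP[u uY /eqP E].
by rewrite /f -E; apply: map_f.
Qed.

End Necessity.

(** * Perfect matchings and tilings *)

Lemma ell_shift n (u w : 'I_(2 * n)) z : 0 < z <= n ->
  w = (u + z) %% (2 * n) :> nat -> u != w /\ ell u w = z.
Proof.
move=> hz hw; have hu := ltn_ord u; have hw' := ltn_ord w.
rewrite -val_eqE /= /ell; move: (nat_of_ord u) (nat_of_ord w) hw hu hw' => i j Ej hi hj.
have [h|h] := ltnP (i + z) (2 * n).
  by rewrite modn_small // in Ej; split; lia.
have Ej' : j = i + z - 2 * n.
  by rewrite Ej -{1}(subnK h) modnDr modn_small; lia.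
split; lia.
Qed.

Lemma ell_shiftP n (u w : 'I_(2 * n)) z : 0 < z -> ell u w = z ->
  w = (u + z) %% (2 * n) :> nat \/ u = (w + z) %% (2 * n) :> nat.
Proof.
move=> z0; rewrite /ell; have := ltn_ord u; have := ltn_ord w.
move: (nat_of_ord u) (nat_of_ord w) => i j hj hi E.
have H k l : k <= l -> l < 2 * n -> minn (l - k) (2 * n - (l - k)) = z ->
    l = (k + z) %% (2 * n) \/ k = (l + z) %% (2 * n).
  move=> kl ln; rewrite /minn; case: ltnP => h Ez.
    by left; rewrite modn_small; lia.
  right; have -> : l + z = k + 2 * n by lia.
  by rewrite modnDr modn_small; lia.
case: (leqP i j) => h; [|apply/or_comm]; apply: H => //; lia.
Qed.

Section Bridge.
Variables (n x y a : nat).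
Hypotheses (hx : 1 <= x <= n) (hy : 1 <= y <= n) (hxy : x <> y) (ha : 1 <= a < n).
Let N := 2 * n.

Lemma edges_starts z (E : seq {set 'I_N}) :
    (forall e, e \in E -> exists u w : 'I_N,
       e = [set u; w] /\ w = (u + z) %% N :> nat) ->
  exists2 X : seq nat, size X = size E & forall e, e \in E -> forall v : 'I_N,
    v \in e -> (v : nat) \in X ++ [seq (u + z) %% N | u <- X].
Proof.
elim: E => [|e E IH] H; first by exists [::].
have [u [w [Ee Ew]]] := H e (mem_head _ _).
have [|X sX HX] := IH; first by move=> e' he'; apply: H; rewrite inE he' orbT.
exists ((u : nat) :: X) => /=; first by rewrite sX.
move=> e'; rewrite inE => /orP[/eqP -> v|he' v vin]; last first.
  have := HX _ he' _ vin; rewrite inE !mem_cat inE => /orP[->|->]; rewrite ?orbT //.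
rewrite Ee !inE mem_cat inE => /orP[/eqP ->|/eqP ->]; first by rewrite eqxx.
by rewrite -Ew eqxx !orbT.
Qed.

Lemma matching_to_tiling (F : {set {set 'I_N}}) :
    perfect_matching F -> perm_eq (lengths F) (nseq (n - a) x ++ nseq a y) ->
  exists X Y, size Y = a /\ cyclic_tiling N x y X Y.
Proof.
case/and4P=> _ /forall_inP edF _ /eqP covF lenF.
pose E z := [seq e <- enum F | edge_length e == z].
have HE z : 0 < z -> forall e, e \in E z -> exists u w : 'I_N,
       e = [set u; w] /\ w = (u + z) %% N :> nat.
  move=> z0 e; rewrite mem_filter mem_enum => /andP[/eqP ez eF].
  have /cards2P[u [w [uw Ee]]] := edF _ eF.
  move: ez; rewrite Ee edge_lengthE // => /(ell_shiftP z0)[h|h]; first by exists u, w.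
  by exists w, u; rewrite setUC.
have sE z : size (E z) = count_mem z (nseq (n - a) x ++ nseq a y).
  by rewrite -(permP lenF) size_filter /lengths /image_mem count_map.
have x0 : 0 < x by case/andP: hx.
have y0 : 0 < y by case/andP: hy.
have [X sX HX] := edges_starts (HE x x0).
have [Y sY HY] := edges_starts (HE y y0).
have yx : (y == x) = false by apply/eqP => yx; apply: hxy.
have xy : (x == y) = false by apply/eqP.
have {}sX : size X = n - a.
  by rewrite sX sE count_cat !count_nseq /= eqxx yx; lia.
have {}sY : size Y = a.
  by rewrite sY sE count_cat !count_nseq /= eqxx xy; lia.
exists X, Y; split=> //; rewrite /cyclic_tiling; set L := _ ++ _.
(* [L] contains all [N] residues and has at most [N] entries, so it is a permutation of them. *)
have sub : {subset iota 0 N <= L}.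
  move=> k; rewrite mem_iota => kN.
  have : Ordinal (kN : k < N) \in cover F by rewrite covF inE.
  case/bigcupP=> e eF ke.
  have : edge_length e \in nseq (n - a) x ++ nseq a y.
    by rewrite -(perm_mem lenF); apply: image_f.
  rewrite mem_cat !mem_nseq => /orP[]/andP[_ ez].
    have /HX/(_ _ ke) : e \in E x by rewrite mem_filter ez mem_enum.
    by rewrite /L !mem_cat /= => /orP[->|->]; rewrite ?orbT.
  have /HY/(_ _ ke) : e \in E y by rewrite mem_filter ez mem_enum.
  by rewrite /L !mem_cat /= => /orP[->|->]; rewrite ?orbT.
have sL : size L <= size (iota 0 N).
  rewrite /L !size_cat !size_map size_iota sY sX /N; lia.
have ui := iota_uniq 0 N.
rewrite perm_sym; apply: uniq_perm => //; first exact: leq_size_uniq ui sub sL.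
by case: (uniq_min_size ui sub sL).
Qed.

Lemma tiling_to_matching X Y : size Y = a -> cyclic_tiling N x y X Y ->
  exists F : {set {set 'I_N}},
    perfect_matching F /\ perm_eq (lengths F) (nseq (n - a) x ++ nseq a y).
Proof.
move=> sY tXY; have sX : size X = n - a.
  by have := cyclic_tiling_size tXY; rewrite sY /N; move: (size X) => k; lia.
have N0 : 0 < N by rewrite /N; lia.
(* The default is never reached: [o] is only used on residues below [N]. *)
pose o k : 'I_N := insubd (Ordinal N0) k.
have oK k : k < N -> o k = k :> nat by move=> kN; rewrite val_insubd kN.
have ordK (v : 'I_N) : o v = v by apply: val_inj; rewrite /= oK.
pose edge z u := [set o u; o ((u + z) %% N)].
have edgeP z u : 0 < z <= n -> u < N ->
    o u != o ((u + z) %% N) /\ edge_length (edge z u) = z.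
  move=> hz uN; have [|ne le] := @ell_shift n (o u) (o ((u + z) %% N)) z hz.
    by rewrite !oK // ltn_mod.
  by split=> //; rewrite edge_lengthE.
have XN u : u \in X -> u < N.
  by move=> uX; have := perm_mem tXY u; rewrite mem_iota !mem_cat uX /= add0n => <-.
have YN u : u \in Y -> u < N.
  by move=> uY; have := perm_mem tXY u; rewrite mem_iota !mem_cat uY !orbT add0n /= => <-.
pose E := [seq edge x u | u <- X] ++ [seq edge y u | u <- Y].
have sE : size E = n by rewrite size_cat !size_map sX sY; lia.
pose F := [set e in E].
have cF e : e \in F -> #|e| = 2.
  rewrite inE mem_cat => /orP[]/mapP[u us ->]; rewrite cards2.
    by have [-> _] := edgeP x u hx (XN _ us).
  by have [-> _] := edgeP y u hy (YN _ us).
have covF : cover F = [set: 'I_N].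
  apply/setP => v; rewrite inE; apply/bigcupP.
  have inF z u s : {subset [seq edge z w | w <- s] <= E} -> u \in s -> edge z u \in F.
    by move=> sub us; rewrite inE; apply/sub/map_f.
  have sX' : {subset [seq edge x w | w <- X] <= E} by move=> e; rewrite mem_cat => ->.
  have sY' : {subset [seq edge y w | w <- Y] <= E}.
    by move=> e; rewrite mem_cat => ->; rewrite orbT.
  have : (v : nat) \in iota 0 N by rewrite mem_iota /= ltn_ord.
  rewrite -(perm_mem tXY) !mem_cat => /or4P[vX|/mapP[u uX Ev]|vY|/mapP[u uY Ev]].
  - by exists (edge x v); [exact: inF vX | rewrite !inE ordK eqxx].
  - by exists (edge x u); [exact: inF uX | rewrite !inE -Ev ordK eqxx orbT].
  - by exists (edge y v); [exact: inF vY | rewrite !inE ordK eqxx].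
  - by exists (edge y u); [exact: inF uY | rewrite !inE -Ev ordK eqxx orbT].
have FE : #|F| = #|E| by apply: eq_card => e; rewrite inE.
have Fn : #|F| <= n by rewrite FE -sE card_size.
have sumF : \sum_(A in F) #|A| = #|F| * 2.
  by rewrite (eq_bigr _ cF) sum_nat_const.
(* At most [n] pairs cover [2 * n] vertices: there are exactly [n], pairwise disjoint, and [E] has
   no repetition. *)
have [le eqt] := leq_card_cover F.
have cN : #|cover F| = 2 * n by rewrite covF cardsT card_ord.
have cardF : #|F| = n by move: le; rewrite sumF cN; lia.
have tF : trivIset F by rewrite -eqt sumF cN cardF mulnC.
have uE : uniq E by apply/card_uniqP; rewrite -FE cardF sE.
exists F; split.
  apply/and4P; split; rewrite ?cardF ?covF //.
  by apply/forall_inP => e eF; rewrite /is_edge cF.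
have PE : perm_eq (enum F) E.
  by apply: uniq_perm; rewrite ?enum_uniq // => e; rewrite mem_enum inE.
apply: perm_trans (perm_map _ PE) _; rewrite map_cat -!map_comp.
have cst z s : (forall u, u \in s -> edge_length (edge z u) = z) ->
    [seq (@edge_length N \o edge z) i | i <- s] = nseq (size s) z.
  elim: s => //= u s IH H; rewrite H ?mem_head // IH // => w ws.
  by apply: H; rewrite inE ws orbT.
rewrite !cst ?sX ?sY // => u us.
  by have [_ ->] := edgeP y u hy (YN _ us).
by have [_ ->] := edgeP x u hx (XN _ us).
Qed.
End Bridge.

Lemma matching_tilingP n x y a :
    1 <= x <= n -> 1 <= y <= n -> x <> y -> 1 <= a < n ->
  (exists F : {set {set 'I_(2 * n)}},
     perfect_matching F /\ perm_eq (lengths F) (nseq (n - a) x ++ nseq a y))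
  <-> exists X Y, size Y = a /\ cyclic_tiling (2 * n) x y X Y.
Proof.
move=> hx hy hxy ha; split=> [[F [pF lF]]|[X [Y [sY tXY]]]].
  exact: matching_to_tiling pF lF.
exact: tiling_to_matching sY tXY.
Qed.

(** * Reduction by the common divisor and the three parity cases *)

Theorem theorem1p6 (n x y a : nat)
    (hx : 1 <= x <= n) (hy : 1 <= y <= n) (hxy : x <> y) (ha : 1 <= a < n) :
  let dx := gcdn x (2 * n) in
  let dy := gcdn y (2 * n) in
  let d := gcdn x (gcdn y (2 * n)) in
  (exists F : {set {set 'I_(2 * n)}},
     perfect_matching F /\ perm_eq (lengths F) (nseq (n - a) x ++ nseq a y))
  <->
  d %| n /\
  (
    (~~ odd (x %/ d) /\ odd (y %/ d) /\ ~~ odd (n - a) /\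
       (dx %| n \/ (~~ (dx %| n) /\ dx <= 2 * a)))
  \/
    (odd (x %/ d) /\ ~~ odd (y %/ d) /\ ~~ odd a /\
       (dy %| n \/ (~~ (dy %| n) /\ dy <= 2 * (n - a))))
  \/
    (odd (x %/ d) /\ odd (y %/ d) /\
       (~~ odd a \/ dx <= d * a) /\
       (~~ odd (n - a) \/ dy <= d * (n - a)))).
Proof.
move=> dx dy d; rewrite (matching_tilingP hx hy hxy ha).
have d0 : 0 < d by rewrite gcdn_gt0; case/andP: hx => ->.
have ddx : d %| x := dvdn_gcdl _ _.
have ddy : d %| y := dvdn_trans (dvdn_gcdr _ _) (dvdn_gcdl _ _).
have ddN : d %| 2 * n := dvdn_trans (dvdn_gcdr _ _) (dvdn_gcdr _ _).
have x0 : 0 < x by case/andP: hx.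
have y0 : 0 < y by case/andP: hy.
set x' := x %/ d; set y' := y %/ d.
have Ex : x = d * x' by rewrite mulnC divnK.
have Ey : y = d * y' by rewrite mulnC divnK.
(* As [d] divides [n], division by [d] leaves an even modulus [2 * m], with [x'], [y'] and [2 * m]
   jointly coprime. *)
have reduced : d %| n -> exists m, [/\ n = d * m, 0 < m, 2 * n = d * (2 * m),
    gcdn x' (gcdn y' (2 * m)) = 1
    & dx = d * gcdn x' (2 * m) /\ dy = d * gcdn y' (2 * m)].
  case/dvdnP=> m En; rewrite mulnC in En; exists m; have EN : 2 * n = d * (2 * m) by lia.
  split=> //.
  - by case: m En EN => // En; lia.
  - by apply/eqP; rewrite -(eqn_pmul2l d0) !muln_gcdr -EN -Ex -Ey muln1.
  - by rewrite !muln_gcdr -EN -Ex -Ey.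
split=> [[X [Y [sY tXY]]]|[dn cases]].
  have tYX := cyclic_tilingC tXY.
  have sX : size X = n - a.
    by have := cyclic_tiling_size tXY; rewrite sY; move: (size X) => k; lia.
  have dn : d %| n := cyclic_tiling_dvd tXY (erefl _) d0 ddx ddy ddN.
  have [m [En m0 EN g1 [Edx Edy]]] := reduced dn; split=> //.
  have dx0 : 0 < dx by rewrite gcdn_gt0 x0.
  have dy0 : 0 < dy by rewrite gcdn_gt0 y0.
  case ox: (odd x'); case oy: (odd y').
  - right; right; do 2!split=> //; split.
    + have [oa|] := boolP (odd a); [right | by left].
      have dxn : dx %| n by rewrite Edx En dvdn_pmul2l // odd_gcd_half.
      (* Since [gcdn y dx] equals [d], the bound reads dx / d <= a. *)
      have := cyclic_tiling_even_cycles tXY (erefl _) dx0 (dvdn_gcdl _ _) dxn.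
      rewrite sY gcdnCA -/d => /(_ oa).
      by rewrite leq_divLR ?[a * d]mulnC // Edx dvdn_mulr.
    + have [oa|] := boolP (odd (n - a)); [right | by left].
      have dyn : dy %| n by rewrite Edy En dvdn_pmul2l // odd_gcd_half.
      have := cyclic_tiling_even_cycles tYX (erefl _) dy0 (dvdn_gcdl _ _) dyn.
      rewrite sX -/d => /(_ oa).
      by rewrite leq_divLR ?[_ * d]mulnC // Edy dvdn_mulr.
  - right; left; do 2!split=> //.
    have := cyclic_tiling_parity tYX (erefl _) d0 En Ey Ex (negbT oy) ox.
    rewrite sX => op; split; first by move: op; rewrite oddB; [case: (odd n); case: (odd a) | lia].
    have [|nd] := boolP (dy %| n); [by left | right; split=> //].
    by rewrite -sX; apply: (cyclic_tiling_odd_cycles tYX) => //; rewrite ?dvdn_gcdl ?dvdn_gcdr.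
  - left; do 2!split=> //.
    have := cyclic_tiling_parity tXY (erefl _) d0 En Ex Ey (negbT ox) oy.
    rewrite sY => op; split; first by rewrite oddB ?op ?addbb //; lia.
    have [|nd] := boolP (dx %| n); [by left | right; split=> //].
    by rewrite -sY; apply: (cyclic_tiling_odd_cycles tXY) => //; rewrite ?dvdn_gcdl ?dvdn_gcdr.
  (* Both quotients even would contradict the joint coprimality [g1]. *)
  - have : 2 %| gcdn x' (gcdn y' (2 * m)).
      by rewrite !dvdn_gcd !dvdn2 ox oy oddM.
    by rewrite g1.
have [m [En m0 EN g1 [Edx Edy]]] := reduced dn.
have N1 : 1 < d * (2 * m) by rewrite -EN; clear -ha; lia.
have g1' : gcdn y' (gcdn x' (2 * m)) = 1 by rewrite gcdnCA.
have an : a <= n by clear -ha; lia.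
have code z w b : tiles (d * z)%:R%R (d * w)%:R%R (enum 'Z_(d * (2 * m))) b ->
    exists X Y, size Y = b /\ cyclic_tiling (2 * n) (d * z) (d * w) X Y.
  by rewrite EN; apply: tiles_nat.
rewrite Ex Ey.
case: cases => [[ox [oy [ea hd]]]|[[ox [oy [ea hd]]]|[ox [oy [h1 h2]]]]].
- apply/code/tiles_residues_even; rewrite -?En //.
  by case: hd => [|[_]]; rewrite Edx; [rewrite En dvdn_pmul2l //; left | right].
(* The previous case with the two directions exchanged. *)
- have [|X [Y [sY tXY]]] := code y' x' (n - a).
    apply: tiles_residues_even; rewrite -?En ?leq_subr ?subKn //.
    by case: hd => [|[_]]; rewrite Edy; [rewrite En dvdn_pmul2l //; left | right].
  exists Y, X; split; last exact: cyclic_tilingC.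
  have := cyclic_tiling_size tXY; rewrite sY; move: (size X) => k.
  by clear -an; lia.
- apply/code/tiles_residues_odd; rewrite -?En //.
  + by move=> oa; case: h1 => [/negP//|]; rewrite Edx leq_pmul2l.
  + by move=> oa; case: h2 => [/negP//|]; rewrite Edy leq_pmul2l.
Qed.
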